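(* Let $Z<0$, $N\ge2$ and $n\in\{1,\dots,N-1\}$ be fixed. Assume $\omega>\omega_n^*$. Then: (i) If $2n\ge N$, then $\partial_\omega Q(\Theta_{\omega,n})>0$ for every $\omega>\omega_n^*$. (ii) If $2n<N$, then there exists $\omega_n^\sharp>\omega_n^*$ such that $$\begin{cases}\partial_\omega Q(\Theta_{\omega,n})>0, & \omega>\omega_n^\sharp,\\ \partial_\omega Q(\Theta_{\omega,n})=0, & \omega=\omega_n^\sharp,\\ \partial_\omega Q(\Theta_{\omega,n})<0, & \omega_n^*<\omega<\omega_n^\sharp.\end{cases}$$
   Context: Let $L\ge0$ and let $\mathcal G$ be the star graph with $N$ edges, each identified with $[L,\infty)$; functions on $\mathcal G$ are $N$-tuples, $L^2(\mathcal G)=\bigoplus_{j=1}^N L^2(L,\infty)$, and $Q(\mathbf U)=\|\mathbf U\|_{L^2(\mathcal G)}^2$. Profiles: for $\omega>0$, $\Psi_a(x)=\sqrt{2\omega}\,\operatorname{sech}(\sqrt\omega(x-L)+a)$, $x\ge L$. Put $\alpha_n(t)=\frac nt+\frac{N-n}{\sqrt{1-t^2}}$, $t\in(0,1)$, with unique minimizer $t_n^*=\big(\frac{n^{2/3}}{n^{2/3}+(N-n)^{2/3}}\big)^{1/2}$, and $\omega_n^*=\alpha_n(t_n^* )^2/Z^2=(n^{2/3}+(N-n)^{2/3})^3/Z^2$. For $\omega>\omega_n^*$ let $t_1(\omega)$ be the unique element of $(0,t_n^* )$ with $\alpha_n(t_1(\omega))=-Z\sqrt\omega$, $t_N=\sqrt{1-t_1^2}$,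 $a_1=\operatorname{arctanh}t_1$, $a_N=\operatorname{arctanh}t_N$, and $\Theta_{\omega,n}=(\Psi_{a_1},\dots,\Psi_{a_1},\Psi_{a_N},\dots,\Psi_{a_N})$, with $\Psi_{a_1}$ repeated $n$ times and $\Psi_{a_N}$ repeated $N-n$ times. *)

(* Defs.v *)
From HB Require Import structures.
From mathcomp Require Import all_boot all_order all_algebra.
From mathcomp Require Import all_classical all_reals all_analysis.

Set Implicit Arguments.
Unset Strict Implicit.
Unset Printing Implicit Defensive.

Import Order.TTheory GRing.Theory Num.Theory.
Import numFieldNormedType.Exports.

Local Open Scope classical_set_scope.
Local Open Scope ring_scope.

Section StarGraph.
Context {R : realType}.

Definition sech (x : R) : R := 2 / (expR x + expR (- x)).

Definition artanh (t : R) : R := ln ((1 + t) / (1 - t)) / 2.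

(* A function on the star graph with N edges [L, +oo) is an N-tuple of
   functions R -> R, whose values below L are irrelevant. *)
Definition normL2 (L : R) (N : nat) (U : 'I_N -> R -> R) : R :=
  Num.sqrt (\sum_(j < N)
    (\int[lebesgue_measure]_(x in `[L, +oo[) (`|U j x| ^+ 2))).

Definition Q (L : R) (N : nat) (U : 'I_N -> R -> R) : R := normL2 L U ^+ 2.

Definition Psi (L omega a x : R) : R :=
  Num.sqrt (2 * omega) * sech (Num.sqrt omega * (x - L) + a).

Definition alpha (N n : nat) (t : R) : R :=
  n%:R / t + (N - n)%:R / Num.sqrt (1 - t ^+ 2).

Definition tstar (N n : nat) : R :=
  Num.sqrt (n%:R `^ (2 / 3) / (n%:R `^ (2 / 3) + (N - n)%:R `^ (2 / 3))).

Definition omega_star (Z : R) (N n : nat) : R :=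
  alpha N n (tstar N n) ^+ 2 / Z ^+ 2.

(* The element exists and is unique when Z < 0, 0 < n < N and
   omega_star Z N n < omega; where no such element exists, xget returns 0. *)
Definition t1 (Z : R) (N n : nat) (omega : R) : R :=
  xget 0 [set t | 0 < t < tstar N n /\ alpha N n t = - Z * Num.sqrt omega].

Definition tN (Z : R) (N n : nat) (omega : R) : R :=
  Num.sqrt (1 - t1 Z N n omega ^+ 2).

Definition Theta (L Z : R) (N n : nat) (omega : R) : 'I_N -> R -> R :=
  fun j => if (j < n)%N then Psi L omega (artanh (t1 Z N n omega))
           else Psi L omega (artanh (tN Z N n omega)).

End StarGraph.

Arguments Theta {R} L Z N n omega _ _.

(* Main.v *)
(* The integral of Psi_a ^ 2 over [L, +oo) is 2 sqrt w (1 - tanh a), so with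
   t = t1 w, s = sqrt (1 - t ^ 2), m = N - n and sqrt w = alpha t / (- Z),
     Q = (2 / (- Z)) F t,  F t = (n / t + m / s) (N - n t - m s).
   Since alpha decreases on (0, T), T = tstar, dQ/dw has the sign opposite to
   F', that is, opposite to
     G t = n m (s ^ 2 - t ^ 2) - N (n s ^ 3 - m t ^ 3),
   where n s ^ 3 > m t ^ 3 precisely when t < T. If n >= m then G < 0 on
   (0, T). If n < m then G (0) < 0 < G (T), and G changes sign only once, as
   G t = t ^ 2 D t - n ^ 2 with D increasing. *)

Require Import Defs.
From HB Require Import structures.
From mathcomp Require Import all_boot all_order all_algebra.
From mathcomp Require Import all_classical all_reals all_analysis.
From mathcomp Require Import ring lra.

Import Order.TTheory GRing.Theory Num.Theory.
Import numFieldNormedType.Exports.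

Set Implicit Arguments.
Unset Strict Implicit.
Unset Printing Implicit Defensive.

Local Open Scope classical_set_scope.
Local Open Scope ring_scope.

(** * Algebra on the unit circle [s ^+ 2 + t ^+ 2 = 1] *)

(* Up to the positive factor [t ^+ 2 * s ^+ 3], the derivative along the circle
   [s ^+ 2 + t ^+ 2 = 1] of [(n / t + m / s) * (n + m - n * t - m * s)]. *)
Definition crit {R : realFieldType} (n m t s : R) : R :=
  n * m * (s ^+ 2 - t ^+ 2) - (n + m) * (n * s ^+ 3 - m * t ^+ 3).

(** If [s <= t], both terms of [crit] have the right sign. Otherwise [s + t >= 1] allows an extra
    factor [s + t] on [s ^+ 2 - t ^+ 2]; after dropping the nonnegative multiples of [n - m], the
    bound is [n * m * (s - t)] times [(1 + 2 * (s * t)) - 2 * (1 + s * t)], which is -1. *)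
Lemma crit_lt0 {R : realFieldType} (n m t s : R) :
  0 < m <= n -> 0 < t -> 0 < s -> s ^+ 2 + t ^+ 2 = 1 ->
  m * t ^+ 3 < n * s ^+ 3 -> crit n m t s < 0.
Proof.
move=> /andP[m0 mn] t0 s0 st mts; rewrite /crit.
have n0 : 0 < n by lra.
have nm : 0 < n * m by exact: mulr_gt0.
have [ts|st'] := leP s t.
  have h1 : 0 < (n + m) * (n * s ^+ 3 - m * t ^+ 3) by apply: mulr_gt0; lra.
  have h2 : s ^+ 2 <= t ^+ 2 by rewrite ler_pXn2r ?nnegrE ?(ltW s0) ?(ltW t0).
  have : 0 <= n * m * (t ^+ 2 - s ^+ 2) by apply: mulr_ge0; lra.
  lra.
have h1 : 0 <= n * (n - m) * s ^+ 3.
  by rewrite !mulr_ge0 ?exprn_ge0//; lra.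
have h2 : 0 <= m * (n - m) * t ^+ 3.
  by rewrite !mulr_ge0 ?exprn_ge0//; lra.
have h3 : 0 <= n * m * (s ^+ 2 - t ^+ 2) * (s + t - 1).
  rewrite !mulr_ge0//; first lra; first lra.
    by rewrite subr_ge0 ler_pXn2r ?nnegrE ?(ltW s0) ?(ltW t0) ?(ltW st').
  have h : 1 <= (s + t) ^+ 2.
    by rewrite sqrrD addrAC st lerDl mulrn_wge0// mulr_ge0 ?ltW.
  by rewrite subr_ge0 -(@ler_pXn2r _ 2) ?nnegrE ?addr_ge0 ?ler01 ?(ltW s0)
    ?(ltW t0)// expr1n.
have h4 : 0 < n * m * (s - t) by apply: mulr_gt0; lra.
have h5 : 0 <= n * m * (s - t) * (s * t) by rewrite !mulr_ge0//; lra.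
have ss : s ^+ 2 = 1 - t ^+ 2 by rewrite -st addrK.
have e1 : (s ^+ 3 - t ^+ 3) = (s - t) * (1 + s * t) by ring: ss.
have e2 : (s ^+ 2 - t ^+ 2) * (s + t) = (s - t) * (1 + 2 * (s * t)).
  by ring: ss.
have e : n * m * (s ^+ 2 - t ^+ 2) - (n + m) * (n * s ^+ 3 - m * t ^+ 3) =
  n * m * ((s ^+ 2 - t ^+ 2) * (s + t))
  - n * m * (s ^+ 2 - t ^+ 2) * (s + t - 1) - n * (n - m) * s ^+ 3
  - m * (n - m) * t ^+ 3 - 2 * (n * m) * (s ^+ 3 - t ^+ 3).
  by ring.
rewrite e e1 e2; lra.
Qed.

(* The second factor increases with [t] as long as [t <= s] and [n < m], which
   makes the zero of [crit] unique. *)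
Lemma crit_factor {R : realFieldType} (n m t s : R) : 0 < s ->
  s ^+ 2 + t ^+ 2 = 1 -> crit n m t s =
  t ^+ 2 * (n * (n + m) * (s + (1 + s)^-1) + m * (n + m) * t - 2 * n * m)
  - n ^+ 2.
Proof.
move=> s0 st; have s1 : 1 + s != 0 by lra.
have ss : s ^+ 2 = 1 - t ^+ 2 by rewrite -st addrK.
(* [1 - s ^+ 3] is [(1 - s) * (1 + s + s ^+ 2)], and [t ^+ 2] supplies [(1 - s) * (1 + s)]. *)
have h : t ^+ 2 * (s + (1 + s)^-1) = 1 - s ^+ 3.
  have -> : t ^+ 2 = (1 - s) * (1 + s) by ring: ss.
  by field.
rewrite (_ : t ^+ 2 * _ = n * (n + m) * (t ^+ 2 * (s + (1 + s)^-1)) +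
  m * (n + m) * t ^+ 3 - 2 * n * m * t ^+ 2); last by ring.
rewrite h /crit; ring: ss.
Qed.

(** A nonnegative [crit] forces the second factor of [crit_factor] to be positive; that factor and
    [t ^+ 2] both increase strictly, so their product passes beyond [n ^+ 2]. *)
Lemma crit_ge0_gt0 {R : realFieldType} (n m t s t' s' : R) :
  0 < n < m -> 0 < t < t' -> 0 < s -> t' <= s' ->
  s ^+ 2 + t ^+ 2 = 1 -> s' ^+ 2 + t' ^+ 2 = 1 ->
  0 <= crit n m t s -> 0 < crit n m t' s'.
Proof.
move=> /andP[n0 nm] /andP[t0 tt'] s0 t's' st st'.
have s'0 : 0 < s' by lra.
rewrite !crit_factor// subr_ge0 subr_gt0 => h.
set D := (X in _ <= _ * X) in h; set D' := (X in _ < _ * X).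
have D0 : 0 < D.
  by rewrite -(pmulr_rgt0 _ (exprn_gt0 2 t0)) (lt_le_trans _ h)// exprn_gt0.
have ss' : s' < s by rewrite -(@ltr_pXn2r _ 2) ?nnegrE ?ltW//; nra.
have ss1 : s ^+ 2 = 1 - t ^+ 2 by rewrite -st addrK.
have ss2 : s' ^+ 2 = 1 - t' ^+ 2 by rewrite -st' addrK.
have DD' : D < D'.
  (* As [t + t' < s + s'] on this arc, [s] loses less than [t] gains. The difference [D' - D] is the
     sum of the three expressions in [h1], [h2] and [h3]. *)
  have d : s - s' < t' - t.
    rewrite -(@ltr_pM2r _ (s + s')) ?addr_gt0//.
    have -> : (s - s') * (s + s') = (t' - t) * (t' + t) by ring: ss1 ss2.
    by rewrite ltr_pM2l; lra.
  have i : (1 + s)^-1 < (1 + s')^-1 by rewrite ltf_pV2 ?posrE; lra.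
  have h1 : 0 < m * (n + m) * ((t' - t) - (s - s')).
    by rewrite !mulr_gt0//; lra.
  have h2 : 0 < (m - n) * (n + m) * (s - s') by rewrite !mulr_gt0//; lra.
  have h3 : 0 < n * (n + m) * ((1 + s')^-1 - (1 + s)^-1).
    by rewrite !mulr_gt0//; lra.
  rewrite /D /D'; lra.
apply: (le_lt_trans h); apply: ltr_pM => //; rewrite ?ltW ?exprn_gt0//.
by rewrite ltr_pXn2r ?nnegrE ?ltW//; lra.
Qed.

(* [a] and [b] are the cube roots of [n] and [N - n]. *)
Lemma alpha_decr {R : realFieldType} (a b t s t' s' : R) :
  0 < a -> 0 < b -> 0 < t < t' -> 0 < s -> 0 < s' ->
  s ^+ 2 + t ^+ 2 = 1 -> s' ^+ 2 + t' ^+ 2 = 1 -> b * t' <= a * s' ->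
  a ^+ 3 / t' + b ^+ 3 / s' < a ^+ 3 / t + b ^+ 3 / s.
Proof.
move=> a0 b0 /andP[t0 tt'] s0 s'0 st st' h'.
have ss' : s' < s by rewrite -(@ltr_pXn2r _ 2) ?nnegrE ?ltW//; nra.
have t'0 : 0 < t' by lra.
have bt : 0 < b * t by exact: mulr_gt0.
have bt' : 0 < b * t' by exact: mulr_gt0.
have h : b * t < a * s.
  apply: (@lt_le_trans _ _ (b * t')); first by rewrite ltr_pM2l.
  by rewrite (le_trans h')// ler_pM2l// ltW.
have k : (b * t) * (b * t') * (b * t + b * t') <
         (a * s) * (a * s') * (a * s + a * s').
  apply: ltr_pM; rewrite ?mulr_ge0 ?addr_ge0//; try lra.
  rewrite (@lt_le_trans _ _ (a * s * (b * t')))//; first by rewrite ltr_pM2r.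
  by rewrite ler_pM2l// (lt_trans bt).
rewrite -subr_gt0.
(* On the circle [(s - s') * (s + s')] equals [(t' - t) * (t' + t)], so [t' - t] factors out; each
   cube then gives one [a] or [b] to each of the three factors compared in [k]. *)
have -> : a ^+ 3 / t + b ^+ 3 / s - (a ^+ 3 / t' + b ^+ 3 / s') =
  (t' - t) * ((a * s) * (a * s') * (a * s + a * s') -
   (b * t) * (b * t') * (b * t + b * t')) / (t * t' * (s * s') * (s + s')).
  have e : s ^+ 2 = 1 - t ^+ 2 by rewrite -st; ring.
  have e' : s' ^+ 2 = 1 - t' ^+ 2 by rewrite -st'; ring.
  field: e e'.
  by rewrite !gt_eqF ?addr_gt0.
apply: divr_gt0; first by rewrite mulr_gt0 ?subr_gt0.
by rewrite !(mulr_gt0, addr_gt0).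
Qed.

(** * Pointwise derivative rules and the mass of the profiles *)

(** The mass of a profile involves its shift [a] only through [expR (- a) ^+ 2]; for [a = artanh t]
    this makes [(1 + expR (- a) ^+ 2)^-1] equal to [(1 + t) / 2]. *)
Lemma expR_artanh {R : realType} (t : R) : -1 < t < 1 ->
  expR (- artanh t) ^+ 2 = (1 - t) / (1 + t).
Proof.
move=> /andP[t1 t2]; rewrite -expRM_natl mulrN /artanh.
rewrite (mulrC 2) divfK// expRN lnK ?invf_div// posrE divr_gt0//; lra.
Qed.

Lemma is_derive1D {R : realType} (f g : R -> R) (x df dg : R) :
  is_derive x 1 f df -> is_derive x 1 g dg ->
  is_derive x 1 (fun y => f y + g y) (df + dg).
Proof. exact: is_deriveD. Qed.

Lemma is_derive1M {R : realType} (f g : R -> R) (x df dg : R) :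
  is_derive x 1 f df -> is_derive x 1 g dg ->
  is_derive x 1 (fun y => f y * g y) (df * g x + f x * dg).
Proof.
move=> hf hg; rewrite addrC [df * _]mulrC.
exact: (@is_deriveM _ _ f g x 1 df dg hf hg).
Qed.

Lemma is_derive1Z {R : realType} (c : R) (f : R -> R) (x df : R) :
  is_derive x 1 f df -> is_derive x 1 (fun y => c * f y) (c * df).
Proof. exact: is_deriveZ. Qed.

Lemma is_derive1Dc {R : realType} (c : R) (f : R -> R) (x df : R) :
  is_derive x 1 f df -> is_derive x 1 (fun y => c + f y) df.
Proof.
by move=> hf; rewrite -[df]add0r; apply: is_derive1D => //;
  exact: is_derive_cst.
Qed.

Lemma is_derive1_sqr {R : realType} (f : R -> R) (x df : R) :
  is_derive x 1 f df -> is_derive x 1 (fun y => f y ^+ 2) (2 * f x * df).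
Proof.
move=> hf; have -> : 2 * f x * df = df * f x + f x * df by ring.
exact: is_derive1M.
Qed.

Lemma is_derive1V {R : realType} (f : R -> R) (x df : R) : f x != 0 ->
  is_derive x 1 f df -> is_derive x 1 (fun y => (f y)^-1) (- df / f x ^+ 2).
Proof.
by move=> f0 hf; rewrite mulNr mulrC -mulNr; exact: is_deriveV.
Qed.

Lemma is_derive1_continuous {R : realType} (f : R -> R) (x df : R) :
  is_derive x 1 f df -> {for x, continuous f}.
Proof.
by move=> hf; apply/differentiable_continuous/derivable1_diffP; case: hf.
Qed.

Lemma is_derive_expR_affine {R : realType} (k c L x : R) :
  is_derive x 1 (fun y => expR (- (k * (y - L) + c)))
    (- k * expR (- (k * (x - L) + c))).
Proof.
have -> : (fun y => expR (- (k * (y - L) + c))) =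
  expR \o (fun y => (- k) * y + (k * L - c)).
  by apply/funext => y /=; congr expR; ring.
have -> : - k * expR (- (k * (x - L) + c)) =
  expR ((- k) * x + (k * L - c)) * (- k).
  by rewrite [RHS]mulrC; congr (_ * expR _); ring.
apply: is_derive1_comp.
rewrite (_ : (fun y => _) = fun y => (k * L - c) + - k * y); last first.
  by apply/funext => y; rewrite addrC.
apply: is_derive1Dc; rewrite -[X in is_derive _ _ _ X]mulr1.
exact: is_derive1Z.
Qed.

Lemma Rintegral_Psi2 {R : realType} (L w a : R) : 0 < w ->
  \int[lebesgue_measure]_(x in `[L, +oo[) (`|Psi L w a x| ^+ 2) =
  4 * Num.sqrt w * (1 - (1 + expR (- a) ^+ 2)^-1).
Proof.
move=> w0; set k := Num.sqrt w.
have k0 : 0 < k by rewrite sqrtr_gt0.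
(* In this variable, which tends to 0 at infinity, [sech] becomes [2 * h x / (1 + h x ^+ 2)]. *)
pose h x : R := expR (- (k * (x - L) + a)).
have h0 x : 0 < h x by exact: expR_gt0.
have h1 x : 1 + h x ^+ 2 != 0 by rewrite gt_eqF// addr_gt0// exprn_gt0.
have PsiE x : `|Psi L w a x| ^+ 2 = 8 * w * (h x / (1 + h x ^+ 2)) ^+ 2.
  rewrite real_normK ?num_real// /Psi /sech exprMn sqr_sqrtr ?mulr_ge0 ?ltW//.
  have -> : expR (k * (x - L) + a) = (h x)^-1 by rewrite /h expRN invrK.
  rewrite -/(h x); have hx := lt0r_neq0 (h0 x).
  by field; rewrite h1.
have dh (x : R) : is_derive x (1 : R) h (- k * h x).
  exact: is_derive_expR_affine.
have ch : continuous h.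
  by move=> x; exact: is_derive1_continuous.
(* This is the antiderivative 2 k (1 + tanh (k (x - L) + a)), with limit [4 * k] at infinity. *)
pose F x : R := 4 * k * (1 + h x ^+ 2)^-1.
have dF (x : R) : is_derive x 1 F (`|Psi L w a x| ^+ 2).
  have d1 : is_derive x 1 (fun y => 1 + h y ^+ 2) (2 * h x * (- k * h x)).
    by apply: is_derive1Dc; exact: is_derive1_sqr.
  rewrite (_ : _ ^+ 2 =
    4 * k * (- (2 * h x * (- k * h x)) / (1 + h x ^+ 2) ^+ 2)).
    by apply: is_derive1Z; exact: is_derive1V.
  by rewrite PsiE -(@sqr_sqrtr _ w) ?ltW// -/k; field.
have hoo : h x @[x --> +oo] --> 0.
  rewrite (_ : h = (fun z => expR (- z)) \o (fun x => k * x + (a - k * L)));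
    last first.
    by apply/funext => x; rewrite /h/=; congr expR; ring.
  apply: (@cvg_comp _ _ _ (fun x => k * x + (a - k * L))
    (fun z => expR (- z)) _ (pinfty_nbhs R)); last exact: cvgr_expR.
  apply/cvgryPge => A; exists (k^-1 * (A - (a - k * L))).
  by split=> [|x /ltW]; rewrite ?num_real// ler_pdivrMl// lerBlDr.
rewrite (@Rintegral_ge0_continuous_FTC2y _ _ F _ (4 * k)).
- by rewrite /F /h subrr mulr0 add0r; ring.
- by move=> x _; exact: exprn_ge0.
- apply: continuous_subspaceT => x.
  rewrite (_ : (fun _ => _) = fun x => 8 * w * (h x / (1 + h x ^+ 2)) ^+ 2);
    last by apply/funext.
  apply: cvgM; first exact: cvg_cst.
  have q : {for x, continuous (fun x => h x / (1 + h x ^+ 2))}.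
    apply: cvgM; first exact: ch.
    apply: cvgV => //; apply: cvgD; first exact: cvg_cst.
    exact: (cvgM (ch x) (ch x)).
  exact: (cvgM q q).
- rewrite -[X in _ --> X]mulr1; apply: cvgM; first exact: cvg_cst.
  rewrite -[X in _ --> X]invr1; apply: cvgV => //.
  rewrite -[X in _ --> X]addr0; apply: cvgD; first exact: cvg_cst.
  by rewrite -[X in _ --> X](mulr0 0); exact: (cvgM hoo hoo).
- by move=> x _; case: (dF x).
- apply/cvg_at_right_filter.
  have cF : {for L, continuous F} by exact: is_derive1_continuous.
  exact: cF.
- by move=> x _; rewrite derive1E; exact: derive_val.
Qed.

Lemma sumr_ord_if {R : comNzRingType} (N n : nat) (x y : R) : (n <= N)%N ->
  \sum_(j < N) (if (j < n)%N then x else y) = n%:R * x + (N - n)%:R * y.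
Proof.
move=> nN; rewrite -(big_mkord predT (fun j => if (j < n)%N then x else y)).
rewrite (@big_cat_nat _ _ _ n)//=; congr (_ + _).
  rewrite (eq_big_nat _ _ (F2 := fun=> x)); last by move=> i /= ->.
  by rewrite sumr_const_nat subn0 mulr_natl.
rewrite (eq_big_nat _ _ (F2 := fun=> y)).
  by rewrite sumr_const_nat mulr_natl.
by move=> i /andP[]; rewrite leqNgt => /negbTE ->.
Qed.

Lemma Q_Psi {R : realType} (L w t s : R) (N n : nat) : (n <= N)%N ->
  0 < w -> 0 < t < 1 -> 0 < s < 1 ->
  Q L (fun j : 'I_N => if (j < n)%N then Psi L w (artanh t)
                       else Psi L w (artanh s)) =
  2 * Num.sqrt w * (N%:R - n%:R * t - (N - n)%:R * s).
Proof.
move=> nN w0 t01 s01.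
have I u : 0 < u < 1 -> \int[lebesgue_measure]_(x in `[L, +oo[)
    (`|Psi L w (artanh u) x| ^+ 2) = 2 * Num.sqrt w * (1 - u).
  move=> /andP[u0 u1]; rewrite Rintegral_Psi2// expR_artanh; last lra.
  by field; apply/andP; split; apply: lt0r_neq0; lra.
rewrite /Q /normL2 sqr_sqrtr; last first.
  apply: sumr_ge0 => j _; apply: Rintegral_ge0 => x _; exact: exprn_ge0.
rewrite (eq_bigr (fun j : 'I_N => if (j < n)%N then 2 * Num.sqrt w * (1 - t)
    else 2 * Num.sqrt w * (1 - s))); last first.
  by move=> j _; case: ifP => _; exact: I.
by rewrite sumr_ord_if// natrB//; ring.
Qed.

(** * The minimizer [tstar] and the monotonicity of [alpha] *)

Lemma powR_third_cube {R : realType} (x : R) : 0 <= x -> (x `^ 3^-1) ^+ 3 = x.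
Proof.
by move=> x0; rewrite -powR_mulrn ?powR_ge0// -powRrM mulVf// powRr1.
Qed.

Lemma powR_two_thirds {R : realType} (x : R) : x `^ (2 / 3) = (x `^ 3^-1) ^+ 2.
Proof. by rewrite -powR_mulrn ?powR_ge0// -powRrM mulrC. Qed.

Lemma sqrt_compl {R : realType} (t : R) : 0 < t < 1 ->
  0 < Num.sqrt (1 - t ^+ 2) < 1 /\ Num.sqrt (1 - t ^+ 2) ^+ 2 + t ^+ 2 = 1.
Proof.
move=> /andP[t0 t1]; have h : 0 < 1 - t ^+ 2.
  by rewrite subr_gt0 exprn_ilt1 ?ltW.
rewrite sqr_sqrtr ?ltW// subrK sqrtr_gt0 h; split => //.
by rewrite -[ltRHS]sqrtr1 ltr_sqrt// gtrBl exprn_gt0.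
Qed.

Lemma ltr_sqrt_compl {R : realType} (t t' : R) : 0 < t < t' -> t' < 1 ->
  Num.sqrt (1 - t' ^+ 2) < Num.sqrt (1 - t ^+ 2).
Proof.
move=> /andP[t0 tt'] t'1; have t'0 : 0 < t' by exact: lt_trans tt'.
rewrite ltr_sqrt ?subr_gt0 ?exprn_ilt1// ?ltr_pXn2r ?nnegrE ?ltW
  ?(lt_trans tt')//.
by rewrite ltrD2l ltrN2 ltr_pXn2r ?nnegrE// ltW.
Qed.

(** The equation is the critical point condition of [alpha] after taking cube roots, which makes it
    linear in [tstar] and its circle partner. *)
Lemma tstarP {R : realType} (N n : nat) : (0 < n < N)%N ->
  0 < (tstar N n : R) < 1 /\
  (N - n)%:R `^ 3^-1 * tstar N n =
    n%:R `^ 3^-1 * Num.sqrt (1 - tstar N n ^+ 2) :> R.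
Proof.
move=> /andP[n0 nN]; rewrite /tstar !powR_two_thirds.
set a := n%:R `^ _; set b := (N - n)%:R `^ _.
have a0 : 0 < a :> R by rewrite powR_gt0// ltr0n.
have b0 : 0 < b :> R by rewrite powR_gt0// ltr0n subn_gt0.
have ab : 0 < a ^+ 2 + b ^+ 2 by rewrite addr_gt0// exprn_gt0.
have u0 : 0 < a ^+ 2 / (a ^+ 2 + b ^+ 2) by rewrite divr_gt0// exprn_gt0.
have v0 : 0 < b ^+ 2 / (a ^+ 2 + b ^+ 2) by rewrite divr_gt0// exprn_gt0.
have uv : 1 - a ^+ 2 / (a ^+ 2 + b ^+ 2) = b ^+ 2 / (a ^+ 2 + b ^+ 2).
  by field; exact: lt0r_neq0.
rewrite sqr_sqrtr ?ltW// uv; split.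
  rewrite sqrtr_gt0 u0/= -[ltRHS]sqrtr1 ltr_sqrt//.
  by rewrite ltr_pdivrMr// mul1r ltrDl exprn_gt0.
have sq (x y : R) : 0 < x -> Num.sqrt (x ^+ 2 / y) = x * Num.sqrt y^-1.
  by move=> x0; rewrite sqrtrM ?sqr_ge0// sqrtr_sqr gtr0_norm.
by rewrite !sq// mulrCA.
Qed.

(** Let [a], [b] be the cube roots of [n], [N - n], and T, S the values of t, s at [tstar]; then b t
    < b T = a S < a s. The result gives the sign of the derivative of [alpha] and a hypothesis of
    [crit_lt0]. *)
Lemma lt_tstar {R : realType} (N n : nat) (t : R) : (0 < n < N)%N ->
  0 < t < tstar N n ->
  (N - n)%:R * t ^+ 3 < n%:R * Num.sqrt (1 - t ^+ 2) ^+ 3.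
Proof.
move=> nN /andP[t0 tT]; have [/andP[T0 T1] e] := @tstarP R _ _ nN.
have /andP[n0 nN'] := nN.
have a0 : 0 < n%:R `^ 3^-1 :> R by rewrite powR_gt0// ltr0n.
have b0 : 0 < (N - n)%:R `^ 3^-1 :> R by rewrite powR_gt0// ltr0n subn_gt0.
rewrite -[n%:R]powR_third_cube// -[(N - n)%:R]powR_third_cube//.
rewrite -!exprMn ltr_pXn2r ?nnegrE ?mulr_ge0 ?powR_ge0 ?sqrtr_ge0 ?(ltW t0)//.
have : (N - n)%:R `^ 3^-1 * t < (N - n)%:R `^ 3^-1 * tstar N n.
  by rewrite ltr_pM2l.
rewrite e => /lt_trans -> //.
by rewrite ltr_pM2l// ltr_sqrt_compl// t0.
Qed.

Lemma tstar_eq {R : realType} (N n : nat) : (0 < n < N)%N ->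
  (N - n)%:R * tstar N n ^+ 3 =
  n%:R * Num.sqrt (1 - tstar N n ^+ 2) ^+ 3 :> R.
Proof.
move=> nN; have [_ e] := @tstarP R _ _ nN.
rewrite -[n%:R in RHS]powR_third_cube// -[(N - n)%:R in LHS]powR_third_cube//.
by rewrite -!exprMn e.
Qed.

(** By [tstarP], comparing the two sides amounts to comparing the cube roots of [n] and [N - n]. *)
Lemma tstar_lt_sqrt {R : realType} (N n : nat) : (0 < n)%N -> (2 * n < N)%N ->
  (tstar N n : R) < Num.sqrt (1 - tstar N n ^+ 2).
Proof.
move=> n0 nN2; have nN : (0 < n < N)%N.
  by rewrite n0 (leq_ltn_trans _ nN2)// leq_pmull.
have [/andP[T0 T1] e] := @tstarP R _ _ nN.
have a0 : 0 < n%:R `^ 3^-1 :> R by rewrite powR_gt0// ltr0n.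
rewrite -(ltr_pM2l a0) -e ltr_pM2r//.
rewrite -(@ltr_pXn2r _ 3) ?nnegrE ?powR_ge0//.
by rewrite !powR_third_cube// ltr_nat ltn_subRL addnn -mul2n.
Qed.

(** The case [t' = tstar] is included for the comparison with [omega_star]. *)
Lemma alpha_decreasing {R : realType} (N n : nat) (t t' : R) : (0 < n < N)%N ->
  0 < t < t' -> t' <= tstar N n -> alpha N n t' < alpha N n t.
Proof.
move=> nN tt' t'T; have [/andP[T0 T1] e] := @tstarP R _ _ nN.
have /andP[n0 nN'] := nN.
have a0 : 0 < n%:R `^ 3^-1 :> R by rewrite powR_gt0// ltr0n.
have b0 : 0 < (N - n)%:R `^ 3^-1 :> R by rewrite powR_gt0// ltr0n subn_gt0.
have [|/andP[s0 _] st] := @sqrt_compl R t; first lra.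
have [|/andP[s'0 _] st'] := @sqrt_compl R t'; first lra.
rewrite /alpha -[n%:R]powR_third_cube// -[(N - n)%:R]powR_third_cube//.
apply: alpha_decr => //.
move: t'T; rewrite le_eqVlt => /predU1P[->|t'T]; first by rewrite e.
rewrite ltW// (@lt_trans _ _ ((N - n)%:R `^ 3^-1 * tstar N n))//.
  by rewrite ltr_pM2l.
by rewrite e ltr_pM2l// ltr_sqrt_compl//; lra.
Qed.

(** * The derivative of [alpha] and its inversion between 0 and [tstar] *)

Lemma is_derive_sqrt_compl {R : realType} (t : R) : 0 < t < 1 ->
  is_derive t 1 (fun u => Num.sqrt (1 - u ^+ 2))
    (- t / Num.sqrt (1 - t ^+ 2)).
Proof.
move=> t01; have [/andP[s0 _] _] := sqrt_compl t01.
have h0 : 0 < 1 - t ^+ 2 by rewrite -sqrtr_gt0.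
have -> : - t / Num.sqrt (1 - t ^+ 2) =
  (2 * Num.sqrt (1 - t ^+ 2))^-1 * (-1 * (2 * t * 1)).
  by field; exact: lt0r_neq0.
apply: (@is_derive1_comp _ Num.sqrt (fun u => 1 - u ^+ 2)).
  exact: is_derive1_sqrt.
apply: is_derive1Dc.
rewrite (_ : (fun _ => _) = fun y : R => -1 * y ^+ 2); last first.
  by apply/funext => y; rewrite mulN1r.
by apply: is_derive1Z; exact: is_derive1_sqr.
Qed.

Lemma is_derive_alpha {R : realType} (N n : nat) (t : R) : 0 < t < 1 ->
  is_derive t 1 (alpha N n)
    (((N - n)%:R * t ^+ 3 - n%:R * Num.sqrt (1 - t ^+ 2) ^+ 3) /
     (t ^+ 2 * Num.sqrt (1 - t ^+ 2) ^+ 3)).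
Proof.
move=> t01; have [/andP[s0 _] _] := sqrt_compl t01.
have ds := is_derive_sqrt_compl t01.
move/andP: t01 => [t0 t1]; set s := Num.sqrt _ in s0 ds *.
have -> : ((N - n)%:R * t ^+ 3 - n%:R * s ^+ 3) / (t ^+ 2 * s ^+ 3) =
  n%:R * (- 1 / t ^+ 2) + (N - n)%:R * (- (- t / s) / s ^+ 2).
  by field; rewrite !lt0r_neq0.
apply: is_derive1D; apply: is_derive1Z; apply: is_derive1V => //.
  exact: lt0r_neq0.
exact: lt0r_neq0.
Qed.

Lemma alpha_gt0 {R : realType} (N n : nat) (t : R) : (0 < n < N)%N ->
  0 < t < 1 -> 0 < alpha N n t.
Proof.
move=> /andP[n0 nN] t01; have [/andP[s0 _] _] := sqrt_compl t01.
by rewrite addr_gt0// divr_gt0// ?ltr0n ?subn_gt0//; case/andP: t01.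
Qed.

Lemma alpha_surj {R : realType} (N n : nat) (c : R) : (0 < n < N)%N ->
  alpha N n (tstar N n) < c ->
  exists2 t, 0 < t < tstar N n & alpha N n t = c.
Proof.
move=> nN Tc; have [/andP[T0 T1] _] := @tstarP R _ _ nN.
have c0 : 0 < c by rewrite (lt_trans _ Tc)// alpha_gt0// T0.
have /andP[n0 nN'] := nN; have n0' : 0 < n%:R :> R by rewrite ltr0n.
have sc t : 0 < t < 1 -> n%:R / t < alpha N n t :> R.
  move=> /sqrt_compl[/andP[s0 _] _].
  by rewrite ltrDl divr_gt0// ltr0n subn_gt0.
(* Here the first term of [alpha] alone equals [c], so [alpha] exceeds [c]. *)
pose t0 : R := n%:R / c.
have t00 : 0 < t0 by rewrite divr_gt0.
have t0T : t0 < tstar N n.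
  rewrite ltr_pdivrMr// mulrC -ltr_pdivrMr//.
  by rewrite (lt_trans _ Tc)// sc// T0.
have ct0 : c < alpha N n t0.
  have := sc t0; rewrite {2}/t0 invf_div mulrCA divff ?lt0r_neq0// mulr1.
  by apply; rewrite t00 (lt_trans t0T).
have [||t] := @IVT R (alpha N n) t0 (tstar N n) c (ltW t0T).
- apply: continuous_in_subspaceT => t; rewrite inE/= in_itv/= => /andP[h1 h2].
  apply: is_derive1_continuous; apply: is_derive_alpha.
  by rewrite (lt_le_trans t00)// (le_lt_trans h2).
- by rewrite ge_min le_max (ltW Tc) (ltW ct0) orbT.
rewrite in_itv/= => /andP[h1 h2] h; exists t => //.
rewrite (lt_le_trans t00)//= lt_neqAle h2 andbT.
by apply/eqP => tT; move: Tc; rewrite -tT h ltxx.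
Qed.

Lemma alpha_inj {R : realType} (N n : nat) (t t' : R) : (0 < n < N)%N ->
  0 < t < tstar N n -> 0 < t' < tstar N n ->
  alpha N n t = alpha N n t' -> t = t'.
Proof.
move=> nN /andP[t0 tT] /andP[t'0 t'T] h.
have [tt'|tt'|//] := ltgtP t t'.
  have := @alpha_decreasing R N n t t' nN.
  by rewrite h ltxx t0 tt' ltW// => /(_ isT isT).
have := @alpha_decreasing R N n t' t nN.
by rewrite h ltxx t'0 tt' ltW// => /(_ isT isT).
Qed.

(** * [t1] as the inverse of an explicit frequency map *)

Lemma t1P {R : realType} (Z : R) (N n : nat) (w : R) : Z < 0 ->
  (0 < n < N)%N -> omega_star Z N n < w ->
  0 < t1 Z N n w < tstar N n /\ alpha N n (t1 Z N n w) = - Z * Num.sqrt w.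
Proof.
move=> Z0 nN Tw; have [T01 _] := @tstarP R _ _ nN.
have [|t tT at_] := @alpha_surj R N n (- Z * Num.sqrt w) nN.
  have Z2 : 0 < Z ^+ 2 by rewrite -sqrrN exprn_gt0// oppr_gt0.
  have w0 : 0 < w by rewrite (le_lt_trans _ Tw)// divr_ge0 ?sqr_ge0.
  rewrite -(@ltr_pXn2r _ 2) ?nnegrE ?mulr_ge0 ?sqrtr_ge0 ?oppr_ge0 ?(ltW Z0)//.
    by rewrite exprMn sqrrN sqr_sqrtr ?(ltW w0)// mulrC -ltr_pdivrMr.
  by rewrite ltW// alpha_gt0.
(* The witness [t] rules out the default value of [xget]. *)
rewrite /t1; case: xgetP => [_ ->//|/(_ t)/=].
by case.
Qed.

Lemma omega_star_lt {R : realType} (Z : R) (N n : nat) (t : R) : Z < 0 ->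
  (0 < n < N)%N -> 0 < t < tstar N n ->
  omega_star Z N n < (alpha N n t / Z) ^+ 2.
Proof.
move=> Z0 nN /andP[t0 tT]; have [/andP[T0 T1] _] := @tstarP R _ _ nN.
have Z2 : 0 < Z ^+ 2 by rewrite -sqrrN exprn_gt0// oppr_gt0.
rewrite expr_div_n ltr_pM2r ?invr_gt0//.
rewrite ltr_pXn2r ?nnegrE ?ltW// ?alpha_gt0 ?T0//; last lra.
by apply: alpha_decreasing; rewrite ?t0.
Qed.

(** Squaring the equation that defines [t1] gives the frequency explicitly in terms of [t];
    injectivity of [alpha] makes [t1] a left inverse, as needed to differentiate it. *)
Lemma t1K {R : realType} (Z : R) (N n : nat) (t : R) : Z < 0 ->
  (0 < n < N)%N -> 0 < t < tstar N n ->
  t1 Z N n ((alpha N n t / Z) ^+ 2) = t.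
Proof.
move=> Z0 nN tT; have [/andP[T0 T1] _] := @tstarP R _ _ nN.
have [h1 h2] := t1P Z0 nN (omega_star_lt Z0 nN tT).
apply: (alpha_inj nN h1 tT); rewrite h2 sqrtr_sqr normrM normfV.
rewrite (ltr0_norm Z0) gtr0_norm ?alpha_gt0//; last lra.
by field; rewrite ltr0_neq0.
Qed.

Lemma omega_t1 {R : realType} (Z : R) (N n : nat) (w : R) : Z < 0 ->
  (0 < n < N)%N -> omega_star Z N n < w ->
  (alpha N n (t1 Z N n w) / Z) ^+ 2 = w.
Proof.
move=> Z0 nN Tw; have [_ ->] := t1P Z0 nN Tw.
have w0 : 0 <= w by rewrite ltW// (le_lt_trans _ Tw)// divr_ge0 ?sqr_ge0.
by rewrite -[RHS]sqr_sqrtr//; field; rewrite ltr0_neq0.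
Qed.

(** * The mass as a function of [t1], and its derivative *)

(** The equation for [t1] replaces [Num.sqrt w] by [- alpha N n t / Z], so [w] enters only through
    [t]. *)
Lemma Q_Theta {R : realType} (L Z : R) (N n : nat) (w : R) : Z < 0 ->
  (0 < n < N)%N -> omega_star Z N n < w ->
  let t := t1 Z N n w in
  Q L (Theta L Z N n w) = - 2 / Z *
    (alpha N n t * (N%:R - n%:R * t - (N - n)%:R * Num.sqrt (1 - t ^+ 2))).
Proof.
move=> Z0 nN Tw t; have [/andP[T0 T1] _] := @tstarP R _ _ nN.
have [/andP[t0 tT] ht] := t1P Z0 nN Tw.
have w0 : 0 < w by rewrite (le_lt_trans _ Tw)// divr_ge0 ?sqr_ge0.
have t01 : 0 < t < 1 by rewrite t0 (lt_trans tT).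
have [s01 _] := sqrt_compl t01.
have nN' : (n <= N)%N by case/andP: nN => _ /ltnW.
rewrite Q_Psi// /tN /t ht.
by field; rewrite ltr0_neq0.
Qed.

(** The left side is the product rule for [(n / t + m / s) * (n + m - n * t - m * s)], where s has
    derivative [- t / s]. *)
Lemma crit_div {R : realFieldType} (n m t s : R) : t != 0 -> s != 0 ->
  s ^+ 2 + t ^+ 2 = 1 ->
  (m * t ^+ 3 - n * s ^+ 3) / (t ^+ 2 * s ^+ 3) * (n + m - n * t - m * s) +
    (n / t + m / s) * (- n + m * t / s) = crit n m t s / (t ^+ 2 * s ^+ 3).
Proof.
(* Replacing 1 by [s ^+ 2 + t ^+ 2] in the first term of [crit] leaves an identity of rational
   functions that holds off the circle too. *)
move=> t0 s0 st; rewrite /crit -[s ^+ 2 - t ^+ 2]mulr1 -st.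
by field; rewrite s0.
Qed.

Lemma is_derive_Q_Theta {R : realType} (L Z : R) (N n : nat) (w : R) : Z < 0 ->
  (0 < n < N)%N -> omega_star Z N n < w ->
  let t := t1 Z N n w in
  exists2 c : R, 0 < c & is_derive w 1 (fun w => Q L (Theta L Z N n w))
    (- c * crit n%:R (N - n)%:R t (Num.sqrt (1 - t ^+ 2))).
Proof.
move=> Z0 nN Tw t; have [/andP[T0 T1] _] := @tstarP R _ _ nN.
have [tT ht] := t1P Z0 nN Tw; rewrite -/t in tT ht.
have /andP[t0 tT'] := tT.
have t01 : 0 < t < 1 by rewrite t0 (lt_trans tT').
have [/andP[s0 _] st] := sqrt_compl t01.
have D := lt_tstar nN tT.
have a0 := alpha_gt0 nN t01.
have da := @is_derive_alpha R N n _ t01.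
have ds := is_derive_sqrt_compl t01.
set s := Num.sqrt (1 - t ^+ 2) in s0 st D da ds *.
set da' := (X in is_derive _ _ _ X) in da.
have da'0 : da' < 0.
  by rewrite pmulr_llt0 ?subr_lt0// invr_gt0 mulr_gt0// exprn_gt0.
pose W (u : R) := (alpha N n u / Z) ^+ 2.
have Wt : W t = w by exact: omega_t1.
have dW (u : R) (d : R) : is_derive u 1 (alpha N n) d ->
    is_derive u 1 W (2 * alpha N n u * d / Z ^+ 2).
  move=> h; rewrite (_ : _ / _ = 2 * (alpha N n u / Z) * (Z^-1 * d)).
    apply: is_derive1_sqr.
    rewrite (_ : (fun _ => _) = fun u => Z^-1 * alpha N n u).
      exact: is_derive1Z.
    by apply/funext => v; rewrite mulrC.
  by field; rewrite ltr0_neq0.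
have Z2 : 0 < Z ^+ 2 by rewrite -sqrrN exprn_gt0// oppr_gt0.
have dW0 : 2 * alpha N n t * da' / Z ^+ 2 < 0.
  by rewrite ltr_pdivrMr// mul0r pmulr_rlt0// mulr_gt0.
have near_t : \forall u \near t, 0 < u < tstar N n.
  by near=> u; apply/andP; split; near: u; [exact: lt_nbhsr|exact: lt_nbhsl].
(* [t1] inverts [W] near [t], and [W] has nonzero derivative there. *)
have dt1 : is_derive w 1 (t1 Z N n) (2 * alpha N n t * da' / Z ^+ 2)^-1.
  rewrite -Wt; apply: (@is_derive_inverse _ W).
  - by near=> u; rewrite t1K//; near: u.
  - near=> u; apply: is_derive1_continuous; apply: dW; apply: is_derive_alpha.
    have : 0 < u < tstar N n by near: u.
    lra.
  - exact: ltr0_neq0.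
pose K (u : R) := - 2 / Z *
    (alpha N n u * (N%:R - n%:R * u - (N - n)%:R * Num.sqrt (1 - u ^+ 2))).
have dK : is_derive t 1 K (- 2 / Z * (da' * (N%:R - n%:R * t - (N - n)%:R * s) +
    alpha N n t * (- n%:R + (N - n)%:R * t / s))).
  apply: is_derive1Z; apply: is_derive1M => //.
  rewrite (_ : (fun _ => _) = fun u => N%:R + (- n%:R * u +
     - (N - n)%:R * Num.sqrt (1 - u ^+ 2))); last by apply/funext => u; ring.
  apply: is_derive1Dc.
  rewrite (_ : - n%:R + _ = - n%:R * 1 + - (N - n)%:R * (- t / s));
    last by ring.
  by apply: is_derive1D; apply: is_derive1Z.
(* The formula for the mass requires [omega_star Z N n < v], an open condition that holds at [w]. *)
have near_w : \forall v \near w, (K \o t1 Z N n) v = Q L (Theta L Z N n v).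
  by near=> v; rewrite Q_Theta//; near: v; exact: lt_nbhsr.
(* Positive because [2 / Z] and the derivative of [t1] are both negative. *)
exists (2 / Z * (2 * alpha N n t * da' / Z ^+ 2)^-1 / (t ^+ 2 * s ^+ 3)).
  rewrite divr_gt0//; last by rewrite mulr_gt0 ?exprn_gt0.
  by rewrite nmulr_rgt0 ?invr_lt0// pmulr_rlt0// invr_lt0.
apply: (near_eq_is_derive near_w).
have := is_derive1_comp dK dt1; congr is_derive.
have NE : N%:R = n%:R + (N - n)%:R :> R.
  by rewrite -natrD subnKC//; case/andP: nN => _ /ltnW.
rewrite NE (crit_div _ _ (lt0r_neq0 t0) (lt0r_neq0 s0) st).
by ring.
Unshelve. all: by end_near. Qed.

(** * The zero of [crit] and the threshold frequency *)

(** At [t = 0] the value of [crit] is [- n%:R ^+ 2]; at [tstar] its second term vanishes and the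
    first is positive by [tstar_lt_sqrt]. *)
Lemma crit_root {R : realType} (N n : nat) : (0 < n < N)%N -> (2 * n < N)%N ->
  exists2 t : R, 0 < t < tstar N n &
    crit n%:R (N - n)%:R t (Num.sqrt (1 - t ^+ 2)) = 0.
Proof.
move=> nN nN2; have [T01 e] := @tstarP R _ _ nN.
have /andP[n0 nN'] := nN; have [T0 T1] := andP T01.
have [/andP[S0 S1] _] := sqrt_compl T01.
have n0' : 0 < n%:R :> R by rewrite ltr0n.
have nm : n%:R < (N - n)%:R :> R.
  by rewrite ltr_nat ltn_subRL addnn -mul2n.
pose G (t : R) := crit n%:R (N - n)%:R t (Num.sqrt (1 - t ^+ 2)).
have G0 : G 0 < 0.
  rewrite /G /crit !expr0n/= !subr0 sqrtr1 !expr1n !(mulr0, mulr1, subr0).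
  nra.
have GT : 0 < G (tstar N n).
  rewrite /G /crit -tstar_eq// subrr mulr0 subr0; apply: mulr_gt0.
    by rewrite mulr_gt0// (lt_trans n0').
  by rewrite subr_gt0 ltr_pXn2r ?nnegrE ?(ltW T0) ?(ltW S0)// tstar_lt_sqrt.
have cs : continuous (fun t : R => Num.sqrt (1 - t ^+ 2)).
  move=> t; apply: (@continuous_comp _ _ _ (fun t : R => 1 - t ^+ 2) Num.sqrt).
    apply: cvgB; first exact: cvg_cst.
    exact: exprn_continuous.
  exact: sqrt_continuous.
have [||t] := @IVT R G 0 (tstar N n) 0 (ltW T0).
- apply: continuous_subspaceT => t.
  have c2 : {for t, continuous (fun t : R => Num.sqrt (1 - t ^+ 2) ^+ 2)}.
    exact: (cvgM (cs t) (cs t)).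
  have c3 : {for t, continuous (fun t : R => Num.sqrt (1 - t ^+ 2) ^+ 3)}.
    exact: (cvgM (cs t) c2).
  rewrite /G /crit; apply: cvgB; apply: cvgM; try exact: cvg_cst.
    apply: cvgB => //; exact: exprn_continuous.
  apply: cvgB; apply: cvgM => //; try exact: cvg_cst.
  exact: exprn_continuous.
- by rewrite ge_min le_max (ltW G0) (ltW GT) orbT.
rewrite in_itv/= => /andP[h1 h2] h; exists t => //.
rewrite !lt_neqAle h1 h2 !andbT.
apply/andP; split; apply/eqP => h3.
  by move: G0 h; rewrite -h3 => /ltr0_neq0/eqP.
by move: GT; rewrite -h3 h ltxx.
Qed.

Theorem theorem6p1 (R : realType) (L Z : R) (N n : nat)
    (hL : 0 <= L) (hZ : Z < 0) (hN : (2 <= N)%N) (hn : (1 <= n <= N - 1)%N) :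
  let q := fun omega : R => Q L (Theta L Z N n omega) in
  ((N <= 2 * n)%N ->
     forall omega : R, omega_star Z N n < omega ->
       derivable q omega 1 /\ 0 < derive1 q omega) /\
  ((2 * n < N)%N ->
     exists omega_sharp : R, omega_star Z N n < omega_sharp /\
       (forall omega : R, omega_sharp < omega ->
          derivable q omega 1 /\ 0 < derive1 q omega) /\
       (derivable q omega_sharp 1 /\ derive1 q omega_sharp = 0) /\
       (forall omega : R, omega_star Z N n < omega < omega_sharp ->
          derivable q omega 1 /\ derive1 q omega < 0)).
Proof.
move=> q.
have nN : (0 < n < N)%N.
  by case/andP: hn => -> /=; rewrite -ltnS subn1 prednK// (leq_trans _ hN).
have [/andP[T0 T1] _] := @tstarP R _ _ nN.
have /andP[n0 nN'] := nN; have n0' : 0 < n%:R :> R by rewrite ltr0n.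
have m0 : 0 < (N - n)%:R :> R by rewrite ltr0n subn_gt0.
pose G (t : R) := crit n%:R (N - n)%:R t (Num.sqrt (1 - t ^+ 2)).
have dq w : omega_star Z N n < w -> derivable q w 1 /\
    exists2 c, 0 < c & derive1 q w = - c * G (t1 Z N n w).
  move=> Tw; have [c c0 dc] := is_derive_Q_Theta L hZ nN Tw.
  split; first by case: dc.
  by exists c => //; rewrite derive1E; case: dc.
have circ (t : R) : 0 < t < tstar N n -> 0 < t < 1.
  by move=> /andP[h1 h2]; rewrite h1 (lt_trans h2).
split=> [Nn w Tw|Nn].
  have [d' [c c0 ->]] := dq _ Tw; split=> //.
  have [tT _] := t1P hZ nN Tw.
  have [/andP[s0 _] st] := sqrt_compl (circ _ tT).
  rewrite mulNr -mulrN mulr_gt0// oppr_gt0; apply: crit_lt0 => //.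
  - by rewrite m0 ler_nat leq_subLR addnn -mul2n.
  - by case/andP: tT.
  - exact: lt_tstar.
have nm : n%:R < (N - n)%:R :> R by rewrite ltr_nat ltn_subRL addnn -mul2n.
have [t0 t0T G0] := @crit_root R N n nN Nn.
have G_mono t t' : 0 < t < t' -> t' < tstar N n -> 0 <= G t -> 0 < G t'.
  move=> /andP[h1 tt'] t'T Gt; have t'0 := lt_trans h1 tt'.
  have t'01 : 0 < t' < 1 by rewrite circ// t'0.
  have t01 : 0 < t < 1 by rewrite h1 (lt_trans tt')//; case/andP: t'01.
  have [/andP[s0 _] st] := sqrt_compl t01.
  have [_ st'] := sqrt_compl t'01.
  apply: (crit_ge0_gt0 _ _ s0 _ st st' Gt); rewrite ?n0' ?h1//.
  (* With T, S as the values at [tstar], the chain is t' < T < S < s'. *)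
  rewrite ltW// (lt_trans t'T)// (lt_trans (tstar_lt_sqrt n0 Nn))//.
  by rewrite ltr_sqrt_compl// t'0.
(* The threshold is the frequency at which [t1] equals the zero [t0]. *)
pose ws := (alpha N n t0 / Z) ^+ 2.
have Tws : omega_star Z N n < ws by exact: omega_star_lt.
(* A larger frequency needs a larger value of [alpha], which decreases below [tstar]. *)
have mono w w' : omega_star Z N n < w -> w < w' -> t1 Z N n w' < t1 Z N n w.
  move=> Tw ww'; have Tw' := lt_trans Tw ww'.
  have [/andP[h1 h2] h] := t1P hZ nN Tw.
  have [/andP[h1' h2'] h'] := t1P hZ nN Tw'.
  rewrite ltNge le_eqVlt; apply/negP => /predU1P[E|lt].
    by move: ww'; rewrite -(omega_t1 hZ nN Tw) E (omega_t1 hZ nN Tw') ltxx.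
  have w0 : 0 < w by rewrite (le_lt_trans _ Tw)// divr_ge0 ?sqr_ge0.
  have := @alpha_decreasing R N n (t1 Z N n w) (t1 Z N n w') nN.
  rewrite h1 lt (ltW h2') => /(_ isT isT).
  by rewrite h h' ltr_pM2l ?oppr_gt0// ltr_sqrt// ltNge (ltW ww').
exists ws; split=> //; split; [|split].
- move=> w ww; have Tw := lt_trans Tws ww.
  have [d' [c c0 ->]] := dq _ Tw; split=> //.
  have := mono _ _ Tws ww; rewrite /ws t1K// => tt.
  have [/andP[h1 h2] _] := t1P hZ nN Tw.
  (* Were [G] nonnegative at [t1 Z N n w], which lies below [t0], [G_mono] would make [G t0]
     positive instead of 0. *)
  rewrite mulNr -mulrN mulr_gt0// oppr_gt0 ltNge; apply/negP => /G_mono.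
  move=> /(_ t0); rewrite h1 tt /G G0 ltxx => /(_ isT).
  by case/andP: t0T => _ -> /(_ isT).
- have [d' [c c0 e]] := dq _ Tws; split=> //.
  by rewrite e /ws t1K// /G G0 mulr0.
- move=> w /andP[Tw ww].
  have [d' [c c0 ->]] := dq _ Tw; split=> //.
  have := mono _ _ Tw ww; rewrite /ws t1K// => tt.
  have [/andP[h1 h2] _] := t1P hZ nN Tw.
  rewrite mulNr oppr_lt0 mulr_gt0// (G_mono t0)//; last by rewrite /G G0.
  by case/andP: t0T => ->.
Qed.
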